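(* Let $G_1$, $G_2$ and $G_k$ be generators over alphabets $\Sigma_1$, $\Sigma_2$ and $\Sigma_k$, respectively, where $\Sigma_1\cap\Sigma_2\subseteq\Sigma_k\subseteq\Sigma_1\cup\Sigma_2$. Let $K\subseteq L_m(G_1\parallel G_2\parallel G_k)$ be a language such that $K$ and $\overline{K}$ are conditionally decomposable with respect to $\Sigma_1,\Sigma_2,\Sigma_k$. For $i=1,2$, let $\mathrm{supCN}_{i+k}$ be the supremal controllable and normal sublanguage of $P_{i+k}(K)$ with respect to $L(G_i\parallel G_k)$, $\Sigma_{i+k,u}$ and $Q_{i+k}$. Assume that $\mathrm{supCN}_{1+k}$ and $\mathrm{supCN}_{2+k}$ are synchronously nonconflicting. If $P_k(\mathrm{supCN}_{1+k})\cap P_k(\mathrm{supCN}_{2+k})$ is controllable with respect to $L(G_k)$ and $\Sigma_{k,u}$ and normal with respect to $L(G_k)$ and $Q_k$, then $\mathrm{supCN}_{1+k}\parallel\mathrm{supCN}_{2+k}$ equals the supremal conditionally controllable and conditionally normal sublanguage of $K$ for generators $G_1,G_2,G_k$ and projections $Q_{1+k},Q_{2+k}$.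
   Context: A generator is $G=(Q,\Sigma,f,q_0,Q_m)$ with finite state set $Q$, finite nonempty alphabet $\Sigma$, partial transition function $f:Q\times\Sigma\to Q$ (extended to words), initial state $q_0$ and marked states $Q_m\subseteq Q$; $L(G)=\{s\in\Sigma^*\mid f(q_0,s)\text{ is defined}\}$ and $L_m(G)=\{s\mid f(q_0,s)\in Q_m\}$. $\overline{L}$ denotes the prefix closure of $L$. A (natural) projection $\Sigma^*\to\Sigma_0^*$, $\Sigma_0\subseteq\Sigma$, erases the letters not in $\Sigma_0$. For $L_i\subseteq\Sigma_i^*$, $L_1\parallel L_2=P_1^{-1}(L_1)\cap P_2^{-1}(L_2)$, where $P_i:(\Sigma_1\cup\Sigma_2)^*\to\Sigma_i^*$ are the projections; for generators $\parallel$ is the synchronous product, satisfying $L(G_1\parallel G_2)=L(G_1)\parallel L(G_2)$ and $L_m(G_1\parallel G_2)=L_m(G_1)\parallel L_m(G_2)$. Languages $A,B$ are synchronously nonconflicting if $\overline{A\parallel B}=\overline{A}\parallel\overline{B}$. The global alphabet $\Sigma=\Sigma_1\cup\Sigma_2$ is partitioned into controllable events $\Sigma_c$ and uncontrollable events $\Sigma_u=\Sigma\setminus\Sigma_c$, and $\Sigma_o\subseteq\Sigma$ is the set of observable events. Put $\Sigma_{i+k}=\Sigma_i\cup\Sigma_k$, $\Sigma_{i+k,u}=\Sigma_{i+k}\cap\Sigma_u$, $\Sigma_{i+k,o}=\Sigma_{i+k}\cap\Sigma_o$, $\Sigma_{k,u}=\Sigma_k\cap\Sigma_u$, $\Sigma_{k,o}=\Sigma_k\cap\Sigma_o$.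 $P_{i+k}:\Sigma^*\to\Sigma_{i+k}^*$, $Q_{i+k}:\Sigma_{i+k}^*\to\Sigma_{i+k,o}^*$, $Q_k:\Sigma_k^*\to\Sigma_{k,o}^*$ are projections, and $P_k$ is the projection onto $\Sigma_k^*$. A language $M$ is controllable with respect to a prefix-closed language $L$ and a set of events $\Sigma_u'$ if $\overline{M}\Sigma_u'\cap L\subseteq\overline{M}$. It is normal with respect to $L$ and a projection $Q$ if $\overline{M}=Q^{-1}[Q(\overline{M})]\cap L$. The supremal controllable and normal sublanguage of $M$ with respect to $L,\Sigma_u',Q$ is the union of all sublanguages of $M$ that are controllable with respect to $L,\Sigma_u'$ and normal with respect to $L,Q$ (it is itself such a sublanguage). A language $M\subseteq\Sigma^*$ is conditionally decomposable with respect to $\Sigma_1,\Sigma_2,\Sigma_k$ if $M=P_{1+k}(M)\parallel P_{2+k}(M)$. A language $M\subseteq L_m(G_1\parallel G_2\parallel G_k)$ is conditionally controllable for $G_1,G_2,G_k$ if, for $i=1,2$, $P_{i+k}(M)$ is controllable with respect to $L(G_i\parallel G_k)$ and $\Sigma_{i+k,u}$; it is conditionally normal for $G_1,G_2,G_k$ and $Q_{1+k},Q_{2+k}$ if, for $i=1,2$, $P_{i+k}(M)$ is normal with respect to $L(G_i\parallel G_k)$ and $Q_{i+k}$. The supremal conditionally controllable and conditionally normal sublanguage of $K$ is the largest (with respect to inclusion) sublanguage of $K$ that is both conditionally controllable and conditionally normal; it exists and equals the union of all such sublanguages. *)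

(* Defs.v *)
From mathcomp Require Import all_boot.
From mathcomp Require Import boolp classical_sets.

Set Implicit Arguments.
Unset Strict Implicit.
Unset Printing Implicit Defensive.

Local Open Scope classical_set_scope.

(* All alphabets are finite subsets of one ambient finite type E of events, so
   that words over different alphabets have the same type seq E. Operations
   whose result depends on the word domain (inverse projections, synchronous
   products) take the alphabets as explicit arguments. *)

Definition language (E : finType) : Type := set (seq E).

Section Languages.
Context {E : finType}.
Implicit Types (S : {set E}) (A B L M : language E).

Definition words S : language E := [set w | all (mem S) w].

Definition proj S (w : seq E) : seq E := [seq a <- w | a \in S].

(* Inverse image under the projection S^* -> S0^* *)
Definition inv_proj S (S0 : {set E}) A : language E :=
  words S `&` proj S0 @^-1` A.

Definition prefix_closure L : language E :=
  [set s | exists2 w, L w & prefix s w].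

Definition sync S1 S2 A B : language E :=
  inv_proj (S1 :|: S2) S1 A `&` inv_proj (S1 :|: S2) S2 B.

Definition sync_nonconflicting S1 S2 A B : Prop :=
  prefix_closure (sync S1 S2 A B) =
  sync S1 S2 (prefix_closure A) (prefix_closure B).

Definition controllable L (Su : {set E}) M : Prop :=
  [set rcons s a | s in prefix_closure M & a in [set` Su]] `&` L
    `<=` prefix_closure M.

(* Normality with respect to L and the projection S^* -> S0^* *)
Definition normal S (S0 : {set E}) L M : Prop :=
  prefix_closure M = inv_proj S S0 (proj S0 @` prefix_closure M) `&` L.

(* Supremal sublanguage of M that is controllable with respect to L, Su and
   normal with respect to L and the projection S^* -> S0^* *)
Definition supCN S (S0 : {set E}) L (Su : {set E}) M : language E :=
  \bigcup_(N in [set N | [/\ N `<=` M, controllable L Su N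
                           & normal S S0 L N]]) N.

Definition cond_decomposable S1 S2 Sk M : Prop :=
  M = sync (S1 :|: Sk) (S2 :|: Sk)
        (proj (S1 :|: Sk) @` M) (proj (S2 :|: Sk) @` M).

End Languages.

(* A generator over the alphabet S: the partial transition function
   state * S -> state is extended by "undefined" to the events outside S. *)
Record generator (E : finType) (S : {set E}) := Generator {
  state : finType;
  trans : state -> E -> option state;
  init : state;
  marked : {set state};
  alphabet_neq0 : S != finset.set0;
  trans_out : forall q a, a \notin S -> trans q a = None
}.

Section Generators.
Context {E : finType}.
Implicit Types S : {set E}.

Fixpoint run S (G : generator S) (q : state G) (w : seq E) :
    option (state G) :=
  if w is a :: w' then obind (fun r => run r w') (trans q a) else Some q.

Definition gen_lang S (G : generator S) : language E :=
  [set w | run (init G) w <> None].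

Definition marked_lang S (G : generator S) : language E :=
  [set w | exists2 q, run (init G) w = Some q & q \in marked G].

Section SyncProduct.
Variables (S1 S2 : {set E}) (G1 : generator S1) (G2 : generator S2).

Definition opair (T1 T2 : Type) (x : option T1) (y : option T2) :
    option (T1 * T2) :=
  if x is Some x' then if y is Some y' then Some (x', y') else None else None.

Definition sync_trans (q : state G1 * state G2) (a : E) :
    option (state G1 * state G2) :=
  match a \in S1, a \in S2 with
  | true, true => opair (trans q.1 a) (trans q.2 a)
  | true, false => opair (trans q.1 a) (Some q.2)
  | false, true => opair (Some q.1) (trans q.2 a)
  | false, false => None
  end.

Lemma sync_alphabet_neq0 : S1 :|: S2 != finset.set0.
Proof.
by have := alphabet_neq0 G1; rewrite finset.setU_eq0 negb_and => ->.
Qed.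

Lemma sync_trans_out q a : a \notin S1 :|: S2 -> sync_trans q a = None.
Proof.
by rewrite /sync_trans inE negb_or => /andP[/negPf -> /negPf ->].
Qed.

Definition sync_gen : generator (S1 :|: S2) :=
  @Generator E (S1 :|: S2) (state G1 * state G2)%type sync_trans
    (init G1, init G2) (finset.setX (marked G1) (marked G2))
    sync_alphabet_neq0 sync_trans_out.

Lemma run_sync_gen (q : state sync_gen) w :
  run q w = if all (mem (S1 :|: S2)) w
            then opair (run q.1 (proj S1 w)) (run q.2 (proj S2 w)) else None.
Proof.
elim: w q => [|a w IH] [q1 q2] //=; rewrite /sync_trans inE /=.
case: (a \in S1) (a \in S2) => [] [] //=.
- case: (trans q1 a) => [r1|] /=; last by case: ifP.
  case: (trans q2 a) => [r2|] /=; first by rewrite IH.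
  by case: ifP => // _; case: (run r1 _).
- case: (trans q1 a) => [r1|] /=; first by rewrite IH.
  by case: ifP.
- case: (trans q2 a) => [r2|] /=; first by rewrite IH.
  by case: ifP => // _; case: (run q1 _).
Qed.

Lemma gen_lang_sync :
  gen_lang sync_gen = sync S1 S2 (gen_lang G1) (gen_lang G2).
Proof.
apply/seteqP; split=> w; rewrite /gen_lang /sync /inv_proj /words /=.
  rewrite run_sync_gen /=; case: ifP => // _.
  by case: (run _ (proj S1 w)) => [r1|] //; case: (run _ (proj S2 w)).
move=> [[hw h1] [_ h2]]; rewrite run_sync_gen /= hw; move: h1 h2.
by case: (run _ (proj S1 w)) => [r1|] //; case: (run _ (proj S2 w)).
Qed.

Lemma marked_lang_sync :
  marked_lang sync_gen = sync S1 S2 (marked_lang G1) (marked_lang G2).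
Proof.
apply/seteqP; split=> w; rewrite /marked_lang /sync /inv_proj /words /=.
  move=> [[r1 r2]]; rewrite run_sync_gen /=; case: ifP => // _.
  case: (run _ (proj S1 w)) => [r1'|] //; case: (run _ (proj S2 w)) => // r2'.
  rewrite /= => -[-> ->]; rewrite finset.in_setX => /andP[m1 m2].
  by split; split=> //; [exists r1 | exists r2].
move=> [[hw [r1 e1 m1]] [_ [r2 e2 m2]]]; exists (r1, r2).
  by rewrite run_sync_gen hw /= e1 e2.
by rewrite finset.in_setX m1 m2.
Qed.

End SyncProduct.

Section Conditional.
Variables (S1 S2 Sk : {set E}).
Variables (G1 : generator S1) (G2 : generator S2) (Gk : generator Sk).
Implicit Types M K : language E.

Definition cond_controllable (Su : {set E}) M : Prop :=
  [/\ M `<=` marked_lang (sync_gen (sync_gen G1 G2) Gk),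
      controllable (gen_lang (sync_gen G1 Gk)) ((S1 :|: Sk) :&: Su)
        (proj (S1 :|: Sk) @` M)
    & controllable (gen_lang (sync_gen G2 Gk)) ((S2 :|: Sk) :&: Su)
        (proj (S2 :|: Sk) @` M)].

Definition cond_normal (So : {set E}) M : Prop :=
  [/\ M `<=` marked_lang (sync_gen (sync_gen G1 G2) Gk),
      normal (S1 :|: Sk) ((S1 :|: Sk) :&: So) (gen_lang (sync_gen G1 Gk))
        (proj (S1 :|: Sk) @` M)
    & normal (S2 :|: Sk) ((S2 :|: Sk) :&: So) (gen_lang (sync_gen G2 Gk))
        (proj (S2 :|: Sk) @` M)].

Definition is_supCCN (Su So : {set E}) K M : Prop :=
  [/\ M `<=` K, cond_controllable Su M, cond_normal So M
    & forall N, N `<=` K -> cond_controllable Su N -> cond_normal So N ->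
        N `<=` M].

End Conditional.

End Generators.

(* Main.v *)
(* Write A, B for the two supremal languages. Nonconflictingness makes the
   closure of P_(1+k)(A || B) the set of words of cl A whose projection to Sk
   lies in P_k(cl A) and P_k(cl B), and makes that intersection the closure of
   the intersection of P_k(A) and P_k(B). So controllability and normality pass
   to P_(1+k)(A || B): the component in Sk is handled by the hypothesis on Gk,
   the rest by A alone; symmetrically for 2+k. Maximality holds because each
   projection of a competitor is among the languages united in A (resp. B). *)

Require Import Defs.
From mathcomp Require Import all_boot.
From mathcomp Require Import boolp classical_sets.

Set Implicit Arguments.
Unset Strict Implicit.
Unset Printing Implicit Defensive.

Local Open Scope classical_set_scope.

(** * Projections of words and their prefix closures *)

Section Projections.
Context {E : finType}.
Implicit Types (S T : {set E}) (A B L M : language E) (u v w : seq E).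

Lemma proj_proj S T w : proj S (proj T w) = proj (S :&: T) w.
Proof.
by rewrite /proj -filter_predI; apply: eq_filter => a /=; rewrite inE.
Qed.

Lemma words_proj S w : words S (proj S w).
Proof. exact: filter_all. Qed.

Lemma proj_id S w : words S w -> proj S w = w.
Proof. exact: elimT all_filterP. Qed.

Lemma proj_setIl S T w : words S w -> proj (S :&: T) w = proj T w.
Proof. by move=> Sw; rewrite finset.setIC -proj_proj (proj_id Sw). Qed.

Lemma words_cons S a w : words S (a :: w) = (a \in S /\ words S w).
Proof. by apply/propext; split=> [/andP|? ]; last exact/andP. Qed.

Lemma proj_cons S a w :
  proj S (a :: w) = if a \in S then a :: proj S w else proj S w.
Proof. by []. Qed.

Lemma proj_rcons S w a :
  proj S (rcons w a) = if a \in S then rcons (proj S w) a else proj S w.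
Proof. exact: filter_rcons. Qed.

Lemma prefix_proj S u w : prefix u w -> prefix (proj S u) (proj S w).
Proof. by move=> /prefixP[v ->]; rewrite /proj filter_cat prefix_prefix. Qed.

(** This is the half of [prefix_closure_proj] that needs an argument: a prefix of the projected word
    is cut out of [w] itself. *)
Lemma prefix_proj_lift S u w :
  prefix u (proj S w) -> exists2 v, prefix v w & proj S v = u.
Proof.
elim: w u => [|a w IH] u; first by case: u => // _; exists [::].
rewrite proj_cons; case: ifPn => aS.
  case: u => [_|b u]; first by exists [::].
  rewrite prefix_cons => /andP[/eqP -> /IH[v vw <-]].
  by exists (a :: v); rewrite ?prefix_cons ?eqxx // proj_cons aS.
move=> /IH[v vw <-].
by exists (a :: v); rewrite ?prefix_cons ?eqxx // proj_cons (negPf aS).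
Qed.

Lemma prefix_closure_proj S M :
  prefix_closure (proj S @` M) = proj S @` prefix_closure M.
Proof.
apply/seteqP; split=> u.
  by move=> [_ [w Mw <-]] /prefix_proj_lift[v vw <-]; exists v => //; exists w.
move=> [v [w Mw vw] <-]; exists (proj S w); first by exists w.
exact: prefix_proj.
Qed.

Lemma prefix_closure_words S M :
  M `<=` words S -> prefix_closure M `<=` words S.
Proof.
move=> MS u [w /MS + /prefixP[v E0]].
by rewrite E0 /words /= all_cat => /andP[].
Qed.

Lemma prefix_closureS A B :
  A `<=` B -> prefix_closure A `<=` prefix_closure B.
Proof. by move=> AB u [w /AB Bw uw]; exists w. Qed.

(** The words are merged from the left: a letter private to one alphabet is emitted alone, and when
    both heads are shared they agree and are emitted once. Either word may advance alone, hence the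
    inner induction on [v]. *)
Lemma interleave S T u v :
  words S u -> words T v -> proj (S :&: T) u = proj (S :&: T) v ->
  exists w, [/\ words (S :|: T) w, proj S w = u & proj T w = v].
Proof.
elim: u v => [|a u IHu] v.
  move=> _ Tv e; exists v; split; last exact: proj_id.
    by apply: sub_all Tv => b /= bT; rewrite inE bT orbT.
  by rewrite -(proj_setIl S Tv) finset.setIC -e.
(* The claim [skip] below emits a private head [a] of the first word. It is stated for any [x]
   because the second word varies in the inner induction. *)
rewrite words_cons proj_cons inE => -[aS uS]; rewrite aS /=.
have skip x : words T x -> a \notin T ->
    proj (S :&: T) u = proj (S :&: T) x ->
    exists w, [/\ words (S :|: T) w, proj S w = a :: u & proj T w = x].
  move=> xT aT /(IHu _ uS xT)[w [wST <- <-]]; exists (a :: w).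
  by rewrite !proj_cons words_cons inE aS (negPf aT).
elim: v => [_|b v IHv].
  by case: ifPn => // aT e; apply: skip.
rewrite words_cons proj_cons inE => -[bT vT]; rewrite bT andbT.
have [bS|bS] := boolP (b \in S); last first.
  move=> /(IHv vT)[w [wST wS wT]]; exists (b :: w).
  by rewrite !proj_cons words_cons inE bT orbT (negPf bS) wS wT.
case: ifPn => aT e; last first.
  by apply: skip; rewrite ?words_cons ?proj_cons ?inE ?bS ?bT.
case: e => <- /(IHu _ uS vT)[w [wST <- <-]]; exists (a :: w).
by rewrite !proj_cons words_cons inE aS aT.
Qed.

(** * Projected synchronous products: closure, controllability, normality *)

Lemma syncC S T A B : sync S T A B = sync T S B A.
Proof. by rewrite /sync finset.setUC setIC. Qed.

Lemma sync_nonconflictingC S T A B :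
  sync_nonconflicting S T A B -> sync_nonconflicting T S B A.
Proof. by rewrite /sync_nonconflicting syncC => ->; rewrite syncC. Qed.

Lemma proj_sync S T A B : A `<=` words S -> B `<=` words T ->
  proj S @` sync S T A B =
  A `&` proj (S :&: T) @^-1` (proj (S :&: T) @` B).
Proof.
move=> AS BT; apply/seteqP; split=> u.
  move=> [w [[_ Aw] [_ Bw]] <-]; split=> //; exists (proj T w) => //.
  by rewrite !proj_proj; congr proj; apply/setP => a; rewrite !inE; do !case: (_ \in _).
move=> [Au [v Bv e]].
have [w [wST wS wT]] := interleave (AS _ Au) (BT _ Bv) (esym e).
by exists w => //; split; split=> //=; rewrite ?wS ?wT.
Qed.

(** For the nontrivial inclusion, a prefix [v] from [A] that matches one from [B] on [U] lifts to
    the product of the closures. By nonconflictingness it then extends to a word of [A] matching a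
    full word of [B]. *)
Lemma prefix_closure_projI_sync S T A B :
  let U := S :&: T in
  A `<=` words S -> B `<=` words T -> sync_nonconflicting S T A B ->
  prefix_closure (proj U @` A `&` proj U @` B) =
  proj U @` prefix_closure A `&` proj U @` prefix_closure B.
Proof.
move=> U AS BT nc; apply/seteqP; split=> u.
  rewrite -!prefix_closure_proj => cu.
  by split; move: u cu; apply: prefix_closureS => ? [].
move=> [[v Av <-] Bv].
have : (proj S @` sync S T (prefix_closure A) (prefix_closure B)) v.
  by rewrite proj_sync //; exact: prefix_closure_words.
rewrite -nc -prefix_closure_proj proj_sync // => -[w [Aw Bw] vw].
by exists (proj U w); [split=> //; exists w | exact: prefix_proj].
Qed.

(** The condition on [U] is phrased with the closure of the intersection, so that controllability
    and normality of that intersection apply to it directly. *)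
Lemma prefix_closure_proj_sync S T A B :
  let U := S :&: T in
  A `<=` words S -> B `<=` words T -> sync_nonconflicting S T A B ->
  prefix_closure (proj S @` sync S T A B) =
  prefix_closure A `&`
  proj U @^-1` prefix_closure (proj U @` A `&` proj U @` B).
Proof.
move=> U AS BT nc; rewrite prefix_closure_proj nc proj_sync;
  try exact: prefix_closure_words.
rewrite prefix_closure_projI_sync //; apply/seteqP; split=> w [Aw].
  by move=> Bw; split=> //; split=> //; exists w.
by case.
Qed.

Lemma controllable_proj_sync S T (Su : {set E}) L Lk A B :
  let U := S :&: T in
  A `<=` words S -> B `<=` words T -> sync_nonconflicting S T A B ->
  proj U @` L `<=` Lk ->
  controllable L (S :&: Su) A ->
  controllable Lk (U :&: Su) (proj U @` A `&` proj U @` B) ->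
  controllable L (S :&: Su) (proj S @` sync S T A B).
Proof.
move=> U AS BT nc LLk cA cU; rewrite /controllable prefix_closure_proj_sync //.
move=> _ [[w [Aw Uw] [a aSu <-]] Lwa]; split.
  by apply: cA; split=> //; exists w => //; exists a.
(* An event outside [U] leaves the projection unchanged; only an event of [U] calls on [cU]. *)
have /LLk := imageP (proj U) Lwa; rewrite /= proj_rcons.
case: ifPn => // aU Lkwa; apply: cU; split=> //.
exists (proj U w) => //; exists a => //=.
by move: aSu aU; rewrite /= !inE => /andP[_ ->] /andP[-> ->].
Qed.

(** Normality as saturation under equal observations. In this form it starts from a single word of
    the closure, which suits unions and intersections. *)
Lemma normalP S (S0 : {set E}) L M :
  normal S S0 L M <->
  prefix_closure M `<=` words S `&` L /\
  forall v w, prefix_closure M v -> words S w -> L w ->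
    proj S0 w = proj S0 v -> prefix_closure M w.
Proof.
split=> [nM|[sub closed]].
  split=> [w|v w Mv Sw Lw e]; first by rewrite nM => -[[Sw _] Lw].
  by rewrite nM; split=> //; split=> //; exists v.
apply/seteqP; split=> w.
  by move=> Mw; have [Sw Lw] := sub _ Mw; split=> //; split=> //; exists w.
by move=> [[Sw [v Mv e]] Lw]; apply: closed Mv Sw Lw (esym e).
Qed.

Lemma normal_proj_sync S T (So : {set E}) L Lk A B :
  let U := S :&: T in
  A `<=` words S -> B `<=` words T -> sync_nonconflicting S T A B ->
  proj U @` L `<=` Lk ->
  normal S (S :&: So) L A ->
  normal U (U :&: So) Lk (proj U @` A `&` proj U @` B) ->
  normal S (S :&: So) L (proj S @` sync S T A B).
Proof.
move=> U AS BT nc LLk /normalP[subA clA] /normalP[_ clU]; apply/normalP.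
rewrite prefix_closure_proj_sync //; split=> [w [/subA]//|v w [Av Uv] Sw Lw e].
split; first exact: clA Av Sw Lw e.
apply: clU Uv (words_proj U w) (LLk _ (imageP _ Lw)) _.
(* As [U] lies in [S], what is observed on [U] is determined by what is observed on [S]. *)
have UV x : proj (U :&: So) (proj U x) = proj U (proj (S :&: So) x).
  rewrite !proj_proj; congr proj; apply/setP => a.
  by rewrite !inE; do !case: (_ \in _).
by rewrite !UV e.
Qed.

(** * Supremal controllable and normal sublanguages *)

Section Supremal.
Variables (S So Su : {set E}) (L M : language E).

Lemma supCN_sub : supCN S So L Su M `<=` M.
Proof. by move=> w [N [NM _ _]] /NM. Qed.

(** A prefix of a word of the union is a prefix within one member, so both closure properties can be
    checked in that member. *)
Lemma prefix_closure_supCN w : prefix_closure (supCN S So L Su M) w ->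
  exists N, [/\ controllable L Su N, normal S So L N, prefix_closure N w
              & prefix_closure N `<=` prefix_closure (supCN S So L Su M)].
Proof.
move=> [v [N [NM cN nN] Nv] wv]; exists N; split=> //; first by exists v.
by apply: prefix_closureS => x Nx; exists N.
Qed.

Lemma supCN_controllable : controllable L Su (supCN S So L Su M).
Proof.
move=> _ [[w /prefix_closure_supCN[N [cN _ Nw sub]] [a aSu <-]] Lwa].
by apply/sub/cN; split=> //; exists w => //; exists a.
Qed.

Lemma supCN_normal : normal S So L (supCN S So L Su M).
Proof.
apply/normalP; split=> [w|v w].
  by case/prefix_closure_supCN => N [_ /normalP[+ _] Nw _]; apply.
case/prefix_closure_supCN => N [_ /normalP[_ clN] Nv sub] Sw Lw e.
exact/sub/(clN v).
Qed.

Lemma supCN_max N : N `<=` M -> controllable L Su N -> normal S So L N ->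
  N `<=` supCN S So L Su M.
Proof. by move=> NM cN nN w Nw; exists N. Qed.

End Supremal.

End Projections.

Unset Implicit Arguments.

Theorem theorem13 (E : finType) (S1 S2 Sk Sc So : {set E})
    (G1 : generator S1) (G2 : generator S2) (Gk : generator Sk)
    (K : language E) :
  S1 :&: S2 \subset Sk ->
  Sk \subset S1 :|: S2 ->
  Sc \subset S1 :|: S2 ->
  So \subset S1 :|: S2 ->
  K `<=` marked_lang (sync_gen (sync_gen G1 G2) Gk) ->
  cond_decomposable S1 S2 Sk K ->
  cond_decomposable S1 S2 Sk (prefix_closure K) ->
  let Su := (S1 :|: S2) :\: Sc in
  let S1k := S1 :|: Sk in
  let S2k := S2 :|: Sk in
  let supCN1 := supCN S1k (S1k :&: So) (gen_lang (sync_gen G1 Gk))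
                  (S1k :&: Su) (proj S1k @` K) in
  let supCN2 := supCN S2k (S2k :&: So) (gen_lang (sync_gen G2 Gk))
                  (S2k :&: Su) (proj S2k @` K) in
  let M0 := (proj Sk @` supCN1) `&` (proj Sk @` supCN2) in
  sync_nonconflicting S1k S2k supCN1 supCN2 ->
  controllable (gen_lang Gk) (Sk :&: Su) M0 ->
  normal Sk (Sk :&: So) (gen_lang Gk) M0 ->
  is_supCCN G1 G2 Gk Su So K (sync S1k S2k supCN1 supCN2).
Proof.
move=> S12k _ _ _ KLm decK _ Su S1k S2k A B M0 nc cM0 nM0.
(* This identifies the shared alphabet [U] of the transfer lemmas with [Sk], where the hypotheses on
   [M0] live. *)
have eU : S1k :&: S2k = Sk.
  apply/setP => a; rewrite !inE; have := fintype.subsetP S12k a; rewrite inE.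
  by case: (a \in S1) (a \in S2) (a \in Sk) => [] [] [] //= ->.
have eU' : S2k :&: S1k = Sk by rewrite finset.setIC.
have AS : A `<=` words S1k.
  by move=> w /supCN_sub[v _ <-]; exact: words_proj.
have BS : B `<=` words S2k.
  by move=> w /supCN_sub[v _ <-]; exact: words_proj.
have nc' := sync_nonconflictingC nc.
have lang_k S (G : generator S) :
    proj Sk @` gen_lang (sync_gen G Gk) `<=` gen_lang Gk.
  by rewrite gen_lang_sync => _ [w [_ [_ Lw]] <-].
(* Decomposability of [K] reduces membership to the two projections, which lie in [A] and [B]. *)
have MK : sync S1k S2k A B `<=` K.
  rewrite decK => w [[ww /supCN_sub Aw] [_ /supCN_sub Bw]].
  by split; split.
split=> //.
- split; first by move=> w /MK/KLm.
  + apply: (@controllable_proj_sync _ _ _ _ _ (gen_lang Gk)) => //;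
      rewrite ?eU //; exact: supCN_controllable.
  + rewrite syncC; apply: (@controllable_proj_sync _ _ _ _ _ (gen_lang Gk)) => //;
      rewrite ?eU' 1?setIC //; exact: supCN_controllable.
- split; first by move=> w /MK/KLm.
  + apply: (@normal_proj_sync _ _ _ _ _ (gen_lang Gk)) => //;
      rewrite ?eU //; exact: supCN_normal.
  + rewrite syncC; apply: (@normal_proj_sync _ _ _ _ _ (gen_lang Gk)) => //;
      rewrite ?eU' 1?setIC //; exact: supCN_normal.
- move=> N NK [_ cN1 cN2] [_ nN1 nN2] w Nw.
  (* Decomposing [K] at [w] supplies that [w] is a word over the union of [S1k] and [S2k], as
     membership in [sync] demands. *)
  have : K w by exact: NK.
  rewrite decK => -[[ww _] _].
  by split; split=> //; [move: cN1 nN1|move: cN2 nN2];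
    (move=> c n; apply: (supCN_max _ c n); [exact: image_subset|exists w]).
Qed.
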